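(* Let $\mathbb{F}$ be an arbitrary field, let $f \in \mathbb{F}[x_1,\dots,x_r]$ be a polynomial in $r$ variables, and let $x_1^{d_1}\cdots x_r^{d_r}$ be a maximal monomial of $f$. Then for any subsets $B_1,\dots,B_r$ of $\mathbb{F}$ the hypergraph $H(f;B_1,\dots,B_r)$ is free of copies of $K^{(r)}_{d_1+1,\dots,d_r+1}$.
   Context: A monomial $x_1^{d_1}\cdots x_r^{d_r}$ is a monomial of $f$ if its coefficient in $f$ is non-zero; a monomial of $f$ is maximal if it does not divide any other monomial of $f$. A hypergraph consists of a set of vertices and a set of edges, each edge being a subset of the vertex set; it is $r$-uniform if each edge contains exactly $r$ vertices, and an $r$-uniform hypergraph is $r$-partite if its vertex set is a disjoint union of $r$ parts with every edge containing one vertex from each part. The complete $r$-partite $r$-uniform hypergraph with parts of sizes $s_1,\dots,s_r$ contains all $s_1\cdots s_r$ possible edges and is denoted by $K^{(r)}_{s_1,\dots,s_r}$. For subsets $B_1,\dots,B_r$ of $\mathbb{F}$, put $$Z(f;B_1,\dots,B_r) := \{(a_1,\dots,a_r)\in B_1\times\dots\times B_r \mid f(a_1,\dots,a_r)=0\}.$$ The set $Z(f;B_1,\dots,B_r)$ is viewed as the set of edges of an $r$-partite $r$-uniform hypergraph with parts $B_1,\dots,B_r$ (regarded as pairwise disjoint), denoted by $H(f;B_1,\dots,B_r)$; a tuple $(a_1,\dots,a_r)$ is the edge consisting of $a_i$ in the $i$-th part for each $i$.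
   Formalization: A copy is required to place the part of size d_i+1 inside B_i for each i; if the parts may be permuted the claim is false, e.g. r=2, f=x_2^2-x_2, maximal monomial x_2^2, B_1=B_2=F with at least 3 elements. *)

(* Defs.v *)
From mathcomp Require Import all_boot all_order all_algebra.
From mathcomp Require Import boolp classical_sets functions cardinality.
From mathcomp.multinomials Require Import mpoly.

Set Implicit Arguments.
Unset Strict Implicit.
Unset Printing Implicit Defensive.

Local Open Scope classical_set_scope.
Local Open Scope card_scope.

(* [(m <= m')%MM] is divisibility of monomials, not the monomial order. *)
Definition maximal_monomial (R : nzRingType) (r : nat) (f : {mpoly R[r]})
    (m : 'X_{1..r}) : Prop :=
  m \in msupp f /\
  forall m' : 'X_{1..r}, m' \in msupp f -> m' <> m -> ~~ (m <= m')%MM.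

Record hypergraph (V : Type) := Hypergraph {
  vertices : set V;
  edges : set (set V);
  edges_sub : forall e, edges e -> e `<=` vertices
}.

Definition uniform (r : nat) (V : Type) (H : hypergraph V) : Prop :=
  forall e, edges H e -> e #= `I_r.

(* The parts are indexed, i.e. they come in a fixed order. *)
Record partite_hypergraph (r : nat) (V : Type) := PartiteHypergraph {
  hypergraph_of :> hypergraph V;
  part : 'I_r -> set V;
  uniform_of : uniform r hypergraph_of;
  parts_cover : vertices hypergraph_of = \bigcup_i part i;
  parts_disjoint : forall i j, i <> j -> part i `&` part j = set0;
  edge_part : forall e i, edges hypergraph_of e -> exists! v, (e `&` part i) v
}.

(* [K^(r)_(s_1, ..., s_r)] has ordered sizes, so a copy of it in a hypergraph
   with ordered parts has its i-th part inside the i-th part. Copies need not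
   be induced. *)
Definition is_copy (r : nat) (V W : Type) (K : partite_hypergraph r V)
    (H : partite_hypergraph r W) (phi : V -> W) : Prop :=
  [/\ {in vertices K &, injective phi},
      forall i v, part K i v -> part H i (phi v)
    & forall e, edges K e -> edges H (phi @` e)].

Definition free_of_copies (r : nat) (V W : Type) (H : partite_hypergraph r W)
    (K : partite_hypergraph r V) : Prop :=
  ~ exists phi : V -> W, is_copy K H phi.

Section TupleHypergraph.
Variables (r : nat) (T : Type) (B : 'I_r -> set T).

Definition box : set ('I_r -> T) := [set a | forall i, B i (a i)].

(* Tagging with the index i makes the parts B_1, ..., B_r disjoint. *)
Definition tagged_part (i : 'I_r) : set ('I_r * T) :=
  [set v | v.1 = i /\ B i v.2].

Definition tuple_edge (a : 'I_r -> T) : set ('I_r * T) :=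
  range (fun i => (i, a i)).

Variables (Z : set ('I_r -> T)) (ZB : Z `<=` box).

Fact tuple_edges_sub e :
  (tuple_edge @` Z) e -> e `<=` \bigcup_i tagged_part i.
Proof. by move=> [a Za <-] _ [i _ <-]; exists i => //; split=> //; exact: ZB. Qed.

Definition tuple_hypergraph0 : hypergraph ('I_r * T) :=
  Hypergraph tuple_edges_sub.

Fact tuple_uniform : uniform r tuple_hypergraph0.
Proof.
move=> _ [a _ <-].
have -> : (tuple_edge a #= `I_r) = ([set: 'I_r] #= `I_r).
  by apply: card_eql; apply: inj_card_eq => i j _ _ [].
by rewrite card_eq_sym card_II.
Qed.

Fact tuple_parts_disjoint i j :
  i <> j -> tagged_part i `&` tagged_part j = set0.
Proof.
by move=> ij; rewrite -subset0 => v [[vi _] [vj _]]; apply: ij; rewrite -vi.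
Qed.

Fact tuple_edge_part e i :
  edges tuple_hypergraph0 e -> exists! v, (e `&` tagged_part i) v.
Proof.
move=> [a Za <-]; exists (i, a i); split.
  by split; [exists i | split=> //; exact: ZB].
by move=> _ [[j _ <-] [/= -> _]].
Qed.

Definition tuple_hypergraph : partite_hypergraph r ('I_r * T) :=
  PartiteHypergraph tuple_uniform erefl tuple_parts_disjoint tuple_edge_part.

End TupleHypergraph.

Definition complete_partite (r : nat) (s : 'I_r -> nat) :
    partite_hypergraph r ('I_r * nat) :=
  tuple_hypergraph (@subset_refl _ (box (fun i => `I_(s i)))).

Section ZeroHypergraph.
Variables (F : fieldType) (r : nat) (f : {mpoly F[r]}) (B : 'I_r -> set F).

Definition zero_set : set ('I_r -> F) := [set a | box B a /\ f.@[a] = 0%R].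

Fact zero_set_sub : zero_set `<=` box B.
Proof. by move=> a []. Qed.

Definition zero_hypergraph : partite_hypergraph r ('I_r * F) :=
  tuple_hypergraph zero_set_sub.

End ZeroHypergraph.

(* Main.v *)
Require Import Defs.
From mathcomp Require Import all_boot all_order all_algebra.
From mathcomp Require Import classical_sets.
From mathcomp.multinomials Require Import mpoly.

(** A copy of the complete hypergraph is a grid of size
    (d_1 + 1) x ... x (d_r + 1) on which f vanishes. By invertibility of the
    Vandermonde matrix, each side of the grid carries a weighted sum that sends
    x^k to 0 for k < d_i and x^(d_i) to 1. The product of these functionals
    kills every monomial of f not divisible by x^d, so by maximality of d it
    sends f to its coefficient at d, which is non-zero. But it sends f to 0,
    being a combination of values of f on the grid. *)

Import GRing.Theory.
Local Open Scope ring_scope.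

Lemma Vandermonde_unitmx (F : fieldType) (n : nat) (a : 'rV[F]_n) :
  injective (a 0) -> Vandermonde n a \in unitmx.
Proof.
move=> a_inj; rewrite unitmxE unitfE det_Vandermonde.
apply/prodf_neq0 => i _; apply/prodf_neq0 => j ij.
by rewrite subr_eq0; apply: contraTneq ij => /a_inj ->; rewrite ltnn.
Qed.

Lemma top_power_weights (F : fieldType) (n : nat) (x : nat -> F) :
  {in [pred k | k <= n]%N &, injective x} ->
  exists w : nat -> F, forall k, (k <= n)%N ->
    \sum_(j < n.+1) w j * x j ^+ k = (k == n)%:R.
Proof.
move=> x_inj; pose V := Vandermonde n.+1 (\row_(j < n.+1) x j).
have Vu : V \in unitmx.
  apply: Vandermonde_unitmx => i j; rewrite !mxE => /x_inj eq_ij.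
  by apply/val_inj/eq_ij; rewrite inE -ltnS.
(* Row [k] of [V] lists the [k]-th powers of the nodes, so the last column of the inverse of [V]
   gives the weights. *)
exists (fun j => (invmx V *m delta_mx ord_max 0 : 'cV_n.+1) (inord j) 0).
move=> k le_kn.
have /matrixP/(_ (inord k) 0) := mulKVmx Vu (delta_mx ord_max 0 : 'cV_n.+1).
rewrite !mxE eqxx andbT -val_eqE /= inordK ?ltnS // => <-.
by apply: eq_bigr => j _; rewrite inord_val mulrC !mxE inordK.
Qed.

Lemma maximal_monomial_grid_neq0 (F : fieldType) (r : nat) (f : {mpoly F[r]})
    (d : 'X_{1..r}) (x : 'I_r -> nat -> F) :
  maximal_monomial f d ->
  (forall i, {in [pred k | k <= d i]%N &, injective (x i)}) ->
  exists g : 'I_r -> nat,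
    (forall i, g i <= d i)%N /\ f.@[fun i => x i (g i)] <> 0.
Proof.
move=> [fd d_max] x_inj.
have /boolp.choice[w wP] i := top_power_weights _ _ _ (x_inj i).
apply: boolp.contrapT => no_g.
have f0 (g : 'I_r -> nat) : (forall i, g i <= d i)%N ->
    f.@[fun i => x i (g i)] = 0.
  by move=> gd; apply: boolp.contrapT => fg; apply: no_g; exists g.
(* The sides of the grid differ in length; indexing all of them in ['I_N] and cutting down by [Q]
   lets the grid points form one finite family. *)
pose N := (\max_i d i).+1.
pose Q i (j : 'I_N) := (j < (d i).+1)%N.
suff: \sum_(g in family Q)
    (\prod_i w i (g i)) * f.@[fun i => x i (g i)] = f@_d.
  rewrite big1 => [/esym/eqP|g /familyP gQ].
    by apply/negP; rewrite -mcoeff_msupp.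
  by rewrite f0 ?mulr0 // => i; have := gQ i; rewrite inE ltnS.
under eq_bigr => g _ do rewrite mevalE mulr_sumr.
rewrite exchange_big /=.
(* By distributivity, the product functional acts on a monomial one variable at a time. *)
have functional_monomial (m : 'X_{1..r}) :
    \sum_(g in family Q)
      (\prod_i w i (g i)) * (f@_m * \prod_i x i (g i) ^+ m i) =
    f@_m * \prod_i \sum_(j < (d i).+1) w i j * x i j ^+ m i.
  under [LHS]eq_bigr => g _ do rewrite mulrCA -big_split /=.
  rewrite -mulr_sumr; congr (_ * _).
  under [RHS]eq_bigr => i _.
    rewrite (big_ord_widen N (fun j => w i j * x i j ^+ m i)); last first.
      by rewrite ltnS leq_bigmax.
    over.
  by rewrite (bigA_distr_big_dep Q (fun i j => w i j * x i j ^+ m i)).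
under eq_bigr => m _ do rewrite functional_monomial.
rewrite (bigD1_seq d) ?msupp_uniq //= big1 ?mulr1 => [|i _]; last first.
  by rewrite wP ?eqxx.
rewrite big_seq_cond big1 ?addr0 // => m /andP[fm /eqP md].
(* Non-divisibility yields a variable [i] with [m i < d i], whose factor vanishes. *)
have := d_max m fm md; move=> /forallPn[i].
rewrite -ltnNge => lt_mi; rewrite (bigD1 i) //= wP ?(ltnW lt_mi) //.
by rewrite (ltn_eqF lt_mi) mul0r mulr0.
Qed.

Theorem lemma2p1 (F : fieldType) (r : nat) (f : {mpoly F[r]})
    (d : 'X_{1..r}) (hd : maximal_monomial f d) (B : 'I_r -> set F) :
  free_of_copies (zero_hypergraph f B) (complete_partite (fun i => (d i).+1)).
Proof.
move=> [phi [phi_inj phi_part phi_edge]].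
(* Since tags are preserved, injectivity of [phi] passes to the field components within each
   part. *)
have phi1 i k : (k <= d i)%N -> (phi (i, k)).1 = i.
  by move=> kd; have [] := phi_part i (i, k) (conj erefl kd).
have in_vertices i k : (k <= d i)%N ->
    (i, k) \in vertices (complete_partite (fun i => (d i).+1)).
  by move=> kd; apply: mem_set; exists i.
have [|g [gd]] :=
    maximal_monomial_grid_neq0 _ _ _ _ (fun i k => (phi (i, k)).2) hd.
  move=> i k l; rewrite !inE => kd ld eq2.
  have [] // : (i, k) = (i, l).
  apply: phi_inj; rewrite ?in_vertices //.
  by rewrite [LHS]surjective_pairing [RHS]surjective_pairing eq2 !phi1.
apply; have [|a [_ fa0] aE] := phi_edge (tuple_edge g); first by exists g.
rewrite -[RHS]fa0; apply: meval_eq => i.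
(* The image edge is [tuple_edge a], whose only vertex tagged [i] is [(i, a i)]. *)
have: (phi @` tuple_edge g)%classic (phi (i, g i)).
  by exists (i, g i) => //; exists i.
rewrite -aE => -[j _ ja]; have := phi1 i (g i) (gd i).
by rewrite -ja /= => ->.
Qed.
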